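(* Let $G$ be a simple graph on $n$ vertices with $k$ connected components, and let $\Phi=\{\phi_i\}_{i\in[n]}$ be an $L_G(n,n-k)$-frame for $\mathbb{C}^{n-k}$. If $S_\Phi$ is the frame operator of $\Phi$, then $\rho^{(2)}_{\Phi,S_\Phi^{-1}\Phi}=1$.
   Context: Write $[n]=\{1,\dots,n\}$; inner products on $\mathbb{C}^d$ are standard and linear in the first argument. A finite sequence $\Phi=\{\phi_i\}_{i\in[n]}$ in $\mathbb{C}^d$ is a frame for $\mathbb{C}^d$ if there are constants $0<A\le B$ with $A\|f\|^2\le\sum_{i\in[n]}|\langle f,\phi_i\rangle|^2\le B\|f\|^2$ for all $f\in\mathbb{C}^d$. Its frame operator is $S_\Phi f=\sum_{i\in[n]}\langle f,\phi_i\rangle\phi_i$ (invertible). A frame $\Psi=\{\psi_i\}_{i\in[n]}$ of $\mathbb{C}^d$ is a dual frame of $\Phi$ if $f=\sum_{i\in[n]}\langle f,\phi_i\rangle\psi_i=\sum_{i\in[n]}\langle f,\psi_i\rangle\phi_i$ for all $f\in\mathbb{C}^d$. The canonical dual frame of $\Phi$ is the dual frame $S_\Phi^{-1}\Phi:=\{S_\Phi^{-1}\phi_i\}_{i\in[n]}$. For a dual frame $\Psi$ of $\Phi$ and $\Lambda\subset[n]$, the error operator is $E_{\Phi,\Psi,\Lambda}(f)=\sum_{i\in\Lambda}\langle f,\phi_i\rangle\psi_i$ on $\mathbb{C}^d$, and for $1\le r<n$, $\rho^{(r)}_{\Phi,\Psi}:=\max\{\rho(E_{\Phi,\Psi,\Lambda}):\Lambda\subset[n],\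 |\Lambda|=r\}$, where $\rho(\cdot)$ is the spectral radius. Graph frames: for a simple graph $G$ with $n$ vertices $v_1,\dots,v_n$ and $n-m$ connected components, the Laplacian matrix is $L(G)=D(G)-A(G)$ (degree matrix minus adjacency matrix); it has rank $m$. Write $L(G)=M\,\mathrm{diag}(\lambda_1,\dots,\lambda_m,0,\dots,0)\,M^*$ with $M$ unitary and $\lambda_1,\dots,\lambda_m$ the nonzero eigenvalues, let $M_1$ be the submatrix formed by the first $m$ columns of $M$, and let $B=\mathrm{diag}(\sqrt{\lambda_1},\dots,\sqrt{\lambda_m})M_1^*$. Then $\{B e_i\}_{i\in[n]}$, with $\{e_i\}$ the standard basis of $\mathbb{C}^n$, is a frame for $\mathbb{C}^m$; any frame arising in this way is called an $L_G(n,m)$-frame. *)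

(* Defs.v *)
From HB Require Import structures.
From mathcomp Require Import all_boot all_order all_algebra.
From mathcomp Require Import spectral sesquilinear complex.
From mathcomp Require Import all_classical all_reals.

Set Implicit Arguments.
Unset Strict Implicit.
Unset Printing Implicit Defensive.

Import Order.TTheory GRing.Theory Num.Theory.
Local Open Scope ring_scope.
Local Open Scope complex_scope.
Local Open Scope sesquilinear_scope.

(* A simple graph on the vertex set 'I_n is given by its adjacency relation;
   its number of connected components is n_comp e predT (from fingraph). *)
Definition simple_graph (n : nat) (e : rel 'I_n) : Prop :=
  symmetric e /\ irreflexive e.

Section Frames.
Variable R : realType.

Definition inner (d : nat) (f g : 'cV[R[i]]_d) : R[i] :=
  \sum_(l < d) f l 0 * (g l 0)^*%R.

Definition frame_fun (n d : nat) (Phi : 'I_n -> 'cV[R[i]]_d)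
    (f : 'cV[R[i]]_d) : 'cV[R[i]]_d :=
  \sum_(i < n) inner f (Phi i) *: Phi i.

Definition error_fun (n d : nat) (Phi Psi : 'I_n -> 'cV[R[i]]_d)
    (L : {set 'I_n}) (f : 'cV[R[i]]_d) : 'cV[R[i]]_d :=
  \sum_(i in L) inner f (Phi i) *: Psi i.

Lemma inner_linearl (d : nat) (a : R[i]) (f f' g : 'cV[R[i]]_d) :
  inner (a *: f + f') g = a * inner f g + inner f' g.
Proof.
rewrite /inner mulr_sumr -big_split; apply: eq_bigr => l _ /=.
by rewrite !mxE mulrDl mulrA.
Qed.

(* linfun is only meaningful on linear maps: the next two lemmas justify its
   use in frame_op and error_op. *)
Lemma frame_fun_is_linear (n d : nat) (Phi : 'I_n -> 'cV[R[i]]_d) :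
  linear (frame_fun Phi).
Proof.
move=> a f g; rewrite /frame_fun scaler_sumr -big_split; apply: eq_bigr => i _.
by rewrite inner_linearl scalerDl scalerA.
Qed.

Lemma error_fun_is_linear (n d : nat) (Phi Psi : 'I_n -> 'cV[R[i]]_d)
  (L : {set 'I_n}) : linear (error_fun Phi Psi L).
Proof.
move=> a f g; rewrite /error_fun scaler_sumr -big_split; apply: eq_bigr => i _.
by rewrite inner_linearl scalerDl scalerA.
Qed.

HB.instance Definition _ n d (Phi : 'I_n -> 'cV[R[i]]_d) :=
  GRing.isLinear.Build R[i] 'cV[R[i]]_d 'cV[R[i]]_d *:%R (frame_fun Phi)
    (frame_fun_is_linear Phi).
HB.instance Definition _ n d (Phi Psi : 'I_n -> 'cV[R[i]]_d) L :=
  GRing.isLinear.Build R[i] 'cV[R[i]]_d 'cV[R[i]]_d *:%R (error_fun Phi Psi L)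
    (error_fun_is_linear Phi Psi L).

Definition frame_op (n d : nat) (Phi : 'I_n -> 'cV[R[i]]_d) :
    'End('cV[R[i]]_d) := linfun (frame_fun Phi).

Definition error_op (n d : nat) (Phi Psi : 'I_n -> 'cV[R[i]]_d)
    (L : {set 'I_n}) : 'End('cV[R[i]]_d) := linfun (error_fun Phi Psi L).

Definition canonical_dual (n d : nat) (Phi : 'I_n -> 'cV[R[i]]_d) :
    'I_n -> 'cV[R[i]]_d := fun i => ((frame_op Phi)^-1)%VF (Phi i).

(* Largest modulus of an eigenvalue; the set is finite, and nonempty as soon as
   0 < d. For d = 0 there is no eigenvalue and sup set0 = 0. *)
Definition spectral_radius (d : nat) (T : 'End('cV[R[i]]_d)) : R :=
  sup [set Normc.normc z | z in [set z : R[i] | passmx.leigenvalue T z]]%classic.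

(* Intended for 1 <= r < n. Spectral radii are nonnegative, so starting the
   maximum at 0 does not change it. *)
Definition max_error_radius (n d : nat) (Phi Psi : 'I_n -> 'cV[R[i]]_d)
    (r : nat) : R :=
  \big[Num.max/0]_(L : {set 'I_n} | #|L| == r)
     spectral_radius (error_op Phi Psi L).

Definition degree_mx (n : nat) (e : rel 'I_n) : 'M[R[i]]_n :=
  \matrix_(i, j) ((i == j)%:R * #|e i|%:R).

Definition adjacency_mx (n : nat) (e : rel 'I_n) : 'M[R[i]]_n :=
  \matrix_(i, j) (e i j)%:R.

Definition laplacian_mx (n : nat) (e : rel 'I_n) : 'M[R[i]]_n :=
  degree_mx e - adjacency_mx e.

(* diag(lam_0, ..., lam_(m-1), 0, ..., 0), of size n *)
Definition padded_diag (m n : nat) (lam : 'rV[R[i]]_m) : 'M[R[i]]_n :=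
  diag_mx (\row_(j < n) oapp (lam 0) 0 (insub (j : nat))).

(* The m x n matrix diag(sqrt lam) M1^*, with M1 the first m columns of M.
   sqrtC is the usual square root on nonnegative reals, and the lam 0 j are
   eigenvalues of a positive semidefinite matrix when this is used. *)
Definition frame_mx (m n : nat) (le_mn : (m <= n)%N) (M : 'M[R[i]]_n)
    (lam : 'rV[R[i]]_m) : 'M[R[i]]_(m, n) :=
  diag_mx (map_mx sqrtC lam) *m (colsub (widen_ord le_mn) M)^t*.

Definition LG_frame (n m : nat) (e : rel 'I_n) (Phi : 'I_n -> 'cV[R[i]]_m) :
    Prop :=
  exists (le_mn : (m <= n)%N) (M : 'M[R[i]]_n) (lam : 'rV[R[i]]_m),
    [/\ M \is unitarymx,
        forall j, lam 0 j != 0,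
        laplacian_mx e = M *m padded_diag n lam *m M^t* &
        forall i, Phi i = frame_mx le_mn M lam *m delta_mx i 0].

End Frames.

(* Main.v *)
(* For a spanning family with frame operator S, an eigenpair E f = z f of an
   error operator of the canonical dual gives, after applying S, that z S f is
   the partial sum over L of the terms <f, phi_i> phi_i of S f.  Pairing with f
   shows that z lies in [0, 1], and z = 1 occurs as soon as some nonzero f is orthogonal to every
   phi_i with i outside L.  For a graph frame the sequences (<f, phi_i>)_i are
   exactly the vectors orthogonal to ker L(G), and e_a - e_b is one of them
   when ab is an edge, because kernel vectors are constant along edges.  An edge
   exists because L(G) has n - k > 0 nonzero eigenvalues. *)
Require Import Defs.
From mathcomp Require Import all_boot all_order all_algebra.
From mathcomp Require Import spectral sesquilinear complex ring.
From mathcomp Require Import all_classical all_reals.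

Import Order.TTheory GRing.Theory Num.Theory.

Local Open Scope ring_scope.
Local Open Scope complex_scope.
Local Open Scope sesquilinear_scope.

(** An eigenvalue is defined by a nonzero eigenspace; [vpick] extracts an eigenvector from it. *)
Lemma leigenvalueP (F : fieldType) (vT : vectType F) (T : 'End(vT)) (a : F) :
  reflect (exists2 v : vT, v != 0 & T v = a *: v) (passmx.leigenvalue T a).
Proof.
have eigE v : (v \in passmx.leigenspace T a) = (T v == a *: v).
  by rewrite memv_ker !lfunE /= opp_lfunE scale_lfunE id_lfunE subr_eq0.
apply: (iffP idP) => [nz | [v nz_v Tv]].
  exists (vpick (passmx.leigenspace T a)); first by rewrite vpick0.
  by apply/eqP; rewrite -eigE memv_pick.
apply: contraNneq nz_v => sp0; rewrite -memv0 -sp0 eigE; exact/eqP.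
Qed.

(** Passes from the modulus valued in [R[i]] to the one valued in [R], where the supremum is
    taken. *)
Lemma normc_le1 (R : rcfType) (z : R[i]) : `|z| <= 1 -> Normc.normc z <= 1.
Proof. by move=> le1; rewrite -lecR. Qed.

(** * Error operators of the canonical dual of a spanning family *)

Section FiniteFrames.
Variables (R : realType) (n d : nat).
Implicit Types (f g : 'cV[R[i]]_d) (Phi : 'I_n -> 'cV[R[i]]_d).

Lemma inner0l g : inner 0 g = 0.
Proof. by rewrite /inner big1 // => l _; rewrite mxE mul0r. Qed.

Lemma innerDl f f' g : inner (f + f') g = inner f g + inner f' g.
Proof. by rewrite -[f]scale1r inner_linearl mul1r scale1r. Qed.

Lemma innerZl a f g : inner (a *: f) g = a * inner f g.
Proof. by rewrite -[a *: f]addr0 inner_linearl inner0l addr0. Qed.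

Lemma inner_suml (I : finType) (P : pred I) (F : I -> 'cV[R[i]]_d) g :
  inner (\sum_(i | P i) F i) g = \sum_(i | P i) inner (F i) g.
Proof.
apply: (big_morph (fun f => inner f g)) => [f f'|]; first exact: innerDl.
exact: inner0l.
Qed.

Lemma inner_conj f g : inner g f = (inner f g)^*%R.
Proof.
rewrite /inner rmorph_sum; apply: eq_bigr => l _.
by rewrite rmorphM /= conjCK mulrC.
Qed.

Lemma inner_partial_sum Phi (L : {pred 'I_n}) f :
  inner (\sum_(i in L) inner f (Phi i) *: Phi i) f =
  \sum_(i in L) `|inner f (Phi i)| ^+ 2.
Proof.
rewrite inner_suml; apply: eq_bigr => i _.
by rewrite innerZl (inner_conj f) normCK.
Qed.

Lemma inner_frame_fun Phi f :
  inner (frame_fun Phi f) f = \sum_i `|inner f (Phi i)| ^+ 2.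
Proof. exact: (inner_partial_sum Phi predT). Qed.

Section Spanning.
Variable Phi : 'I_n -> 'cV[R[i]]_d.
Hypothesis spanning : forall f, (forall i, inner f (Phi i) = 0) -> f = 0.

Lemma inner_frame_fun_gt0 f : f != 0 -> 0 < inner (frame_fun Phi f) f.
Proof.
move=> nz_f; rewrite inner_frame_fun lt_def sumr_ge0 ?andbT; last first.
  by move=> i _; apply: exprn_ge0.
apply: contraNneq nz_f => sum0; apply/eqP/spanning => i; apply/eqP.
rewrite -normr_eq0 -sqrf_eq0; apply/eqP.
by apply: (psumr_eq0P _ sum0) => // j _; apply: exprn_ge0.
Qed.

(** Makes the inverse in [canonical_dual] a genuine left inverse of the frame operator. *)
Lemma lker_frame_op : lker (frame_op Phi) == 0%VS.
Proof.
rewrite -subv0; apply/subvP => f; rewrite memv_ker memv0 lfunE /=.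
move=> /eqP Sf0; apply: contraTT isT => /inner_frame_fun_gt0.
by rewrite Sf0 inner0l ltxx.
Qed.

Lemma frame_op_error_op (L : {set 'I_n}) f :
  frame_op Phi (error_op Phi (canonical_dual Phi) L f) =
  \sum_(i in L) inner f (Phi i) *: Phi i.
Proof.
rewrite [error_op _ _ _ _]lfunE /= /error_fun linear_sum; apply: eq_bigr => i _.
by rewrite linearZ /= /canonical_dual lker0_lfunVK // lker_frame_op.
Qed.

Lemma normr_leigenvalue_canonical_dual (L : {set 'I_n}) (z : R[i]) :
  passmx.leigenvalue (error_op Phi (canonical_dual Phi) L) z -> `|z| <= 1.
Proof.
move=> /leigenvalueP[f nz_f Ef]; have Sf_gt0 := inner_frame_fun_gt0 f nz_f.
have := frame_op_error_op L f; rewrite Ef linearZ /= lfunE /= => zS.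
have {zS}zS : z * inner (frame_fun Phi f) f =
    \sum_(i in L) `|inner f (Phi i)| ^+ 2.
  by rewrite -innerZl zS inner_partial_sum.
(* Multiplying by [<S f, f> > 0] leaves a comparison of the partial sum over [L] with the full
   sum. *)
rewrite -(ler_pM2r Sf_gt0) mul1r -[X in _ * X](gtr0_norm Sf_gt0) -normrM zS.
rewrite ger0_norm; last by apply: sumr_ge0 => i _; apply: exprn_ge0.
rewrite inner_frame_fun [X in _ <= X](bigID (mem L)) /= lerDl.
by apply: sumr_ge0 => i _; apply: exprn_ge0.
Qed.

Lemma leigenvalue1_canonical_dual (L : {set 'I_n}) f :
    f != 0 -> (forall i, i \notin L -> inner f (Phi i) = 0) ->
  passmx.leigenvalue (error_op Phi (canonical_dual Phi) L) 1.
Proof.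
move=> nz_f suppf; apply/leigenvalueP; exists f => //; rewrite scale1r.
(* As [S] is injective, [E f = f] may be checked after applying [S]. *)
apply: (lker0P lker_frame_op); rewrite frame_op_error_op lfunE /=.
rewrite /frame_fun [RHS](bigID (mem L)) /= [X in _ + X]big1 ?addr0 // => i iL.
by rewrite suppf ?scale0r.
Qed.

Lemma normc_leigenvalue_canonical_dual (L : {set 'I_n}) :
  ubound [set Normc.normc z | z in [set z |
    passmx.leigenvalue (error_op Phi (canonical_dual Phi) L) z]]%classic 1.
Proof.
move=> _ /= [z /normr_leigenvalue_canonical_dual lez <-]; exact: normc_le1.
Qed.

Lemma spectral_radius_canonical_dual_le1 (L : {set 'I_n}) :
  spectral_radius (error_op Phi (canonical_dual Phi) L) <= 1.
Proof.
have ub := normc_leigenvalue_canonical_dual L; rewrite /spectral_radius.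
set E := (X in sup X) in ub *.
(* With no eigenvalue, the supremum takes its default value 0. *)
have [-> | nonempty] := eqVneq E set0%classic; first by rewrite sup0 ler01.
by apply: ge_sup => //; apply/set0P.
Qed.

Lemma spectral_radius_canonical_dual_ge1 (L : {set 'I_n}) f :
    f != 0 -> (forall i, i \notin L -> inner f (Phi i) = 0) ->
  1 <= spectral_radius (error_op Phi (canonical_dual Phi) L).
Proof.
move=> nz_f suppf; apply: ub_le_sup.
  by exists 1; apply: normc_leigenvalue_canonical_dual.
exists 1; last exact: Normc.normc1.
exact: leigenvalue1_canonical_dual suppf.
Qed.

Lemma max_error_radius_canonical_dual (r : nat) (L : {set 'I_n}) f :
    #|L| = r -> f != 0 -> (forall i, i \notin L -> inner f (Phi i) = 0) ->
  max_error_radius Phi (canonical_dual Phi) r = 1.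
Proof.
move=> cardL nz_f suppf; apply/eqP; rewrite eq_le; apply/andP; split.
  apply: bigmax_le => [|K _]; first exact: ler01.
  exact: spectral_radius_canonical_dual_le1.
apply: (le_trans (spectral_radius_canonical_dual_ge1 L f nz_f suppf)).
by apply: le_bigmax_cond; rewrite cardL.
Qed.

End Spanning.
End FiniteFrames.

(** * The Laplacian and its kernel *)

Section Laplacian.
Variables (R : realType) (n : nat) (e : rel 'I_n).
Hypothesis sym_e : symmetric e.

Lemma laplacian_mulmx (v : 'cV[R[i]]_n) a :
  (laplacian_mx R e *m v) a 0 = \sum_b (e a b)%:R * (v a 0 - v b 0).
Proof.
rewrite mulmxBl mxE [X in _ + X]mxE; under [RHS]eq_bigr do rewrite mulrBr.
rewrite sumrB; congr (_ - _); rewrite mxE; last first.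
  by apply: eq_bigr => b _; rewrite mxE.
rewrite (bigD1 a) //= big1 ?addr0 => [|b /negPf nab]; last first.
  by rewrite mxE eq_sym nab !mul0r.
rewrite mxE eqxx mul1r -mulr_suml -natr_sum; congr (_%:R * _).
by rewrite -sum1_card big_mkcond.
Qed.

Lemma laplacian_quadratic_form (v : 'cV[R[i]]_n) :
  (\sum_a (v a 0)^*%R * (laplacian_mx R e *m v) a 0) *+ 2 =
  \sum_a \sum_b (e a b)%:R * `|v a 0 - v b 0| ^+ 2.
Proof.
have E1 : \sum_a (v a 0)^*%R * (laplacian_mx R e *m v) a 0 =
    \sum_a \sum_b (e a b)%:R * ((v a 0)^*%R * (v a 0 - v b 0)).
  apply: eq_bigr => a _; rewrite laplacian_mulmx mulr_sumr.
  by apply: eq_bigr => b _; rewrite mulrCA.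
(* One of the two copies gets [a] and [b] exchanged; by symmetry of [e] the paired terms add up to a
   squared modulus. *)
rewrite mulr2n {2}E1 exchange_big /= E1 -big_split; apply: eq_bigr => a _.
rewrite -big_split; apply: eq_bigr => b _ /=.
rewrite (sym_e b a) -mulrDr; congr (_ * _).
by rewrite normCK rmorphB /=; ring.
Qed.

(** The quadratic form vanishes at [v] and is a sum of nonnegative terms, so the term of each edge
    is zero. *)
Lemma laplacian_ker_edge (v : 'cV[R[i]]_n) a b :
  laplacian_mx R e *m v = 0 -> e a b -> v a 0 = v b 0.
Proof.
move=> Lv0 eab; have := laplacian_quadratic_form v; rewrite Lv0 big1.
  rewrite mul0rn => /esym Q0; apply/eqP; rewrite -subr_eq0 -normr_eq0 -sqrf_eq0.
  have ge0 i j : 0 <= (e i j)%:R * `|v i 0 - v j 0| ^+ 2.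
    by rewrite mulr_ge0 ?ler0n ?exprn_ge0.
  have Qa := @psumr_eq0P _ _ predT _
    (fun i _ => sumr_ge0 _ (fun j _ => ge0 i j)) Q0 a isT.
  have := @psumr_eq0P _ _ predT _ (fun j _ => ge0 a j) Qa b isT.
  by rewrite eab mul1r => ->.
by move=> i _; rewrite mxE mulr0.
Qed.

End Laplacian.

(** * Graph frames and the vectors attached to edges *)

Section GraphFrames.
Variables (R : realType) (n m : nat) (e : rel 'I_n).
Variables (le_mn : (m <= n)%N) (M : 'M[R[i]]_n) (lam : 'rV[R[i]]_m).
Hypothesis unitM : M \is unitarymx.
Hypothesis lam_neq0 : forall j, lam 0 j != 0.
Hypothesis laplacianE : laplacian_mx R e = M *m padded_diag n lam *m M^t*.

Let w := widen_ord le_mn.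
Let D : 'rV[R[i]]_m := map_mx sqrtC lam.

Lemma mulmx_tC_unitary : M^t* *m M = 1%:M.
Proof. exact/mulmx1C/unitarymxP. Qed.

Lemma LG_frame_inner (f : 'cV[R[i]]_m) i :
  inner f (frame_mx le_mn M lam *m delta_mx i 0) =
  \sum_j f j 0 * ((D 0 j)^*%R * M i (w j)).
Proof.
rewrite /inner; apply: eq_bigr => j _; congr (_ * _).
by rewrite -colE mxE /frame_mx mul_diag_mx !mxE rmorphM /= conjCK.
Qed.

(** Pairing the coefficients of [f] with column [l] of [M] isolates, by orthonormality of the
    columns, [f l 0] times the conjugate of [D 0 l], which is nonzero. *)
Lemma LG_frame_spanning (f : 'cV[R[i]]_m) :
  (forall i, inner f (frame_mx le_mn M lam *m delta_mx i 0) = 0) -> f = 0.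
Proof.
move=> inner0; apply/matrixP => l c; rewrite ord1 mxE {c}; apply/eqP.
have : \sum_i (M i (w l))^*%R *
    inner f (frame_mx le_mn M lam *m delta_mx i 0) = 0.
  by apply: big1 => i _; rewrite inner0 mulr0.
under eq_bigr do rewrite LG_frame_inner mulr_sumr.
have orth j : \sum_i (M i (w l))^*%R * (f j 0 * ((D 0 j)^*%R * M i (w j))) =
    f j 0 * (D 0 j)^*%R * (l == j)%:R.
  have -> : (l == j)%:R = (M^t* *m M) (w l) (w j).
    by rewrite mulmx_tC_unitary mxE -[w l == w j]val_eqE.
  by rewrite [X in _ = _ * X]mxE mulr_sumr; apply: eq_bigr => i _;
    rewrite !mxE; ring.
rewrite exchange_big /=; under eq_bigr do rewrite orth.
rewrite (bigD1 l) //= eqxx mulr1 big1 => [|j ne_jl]; last first.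
  by rewrite eq_sym (negPf ne_jl) mulr0.
move=> /eqP; rewrite addr0 mulf_eq0 conjC_eq0 mxE sqrtC_eq0.
by rewrite (negPf (lam_neq0 l)) orbF.
Qed.

Lemma laplacian_ker_col (c : 'I_n) :
  (m <= c)%N -> laplacian_mx R e *m col c M = 0.
Proof.
move=> le_mc; rewrite laplacianE colE -!mulmxA (mulmxA _ M).
rewrite mulmx_tC_unitary mul1mx -colE.
suff -> : col c (padded_diag n lam) = 0 by rewrite mulmx0.
apply/matrixP => i j; rewrite !mxE; case: eqP => [->|_]; last exact: mulr0n.
by rewrite insubF ?mul0rn // ltnNge le_mc.
Qed.

Lemma laplacian_has_edge : (0 < m)%N -> exists a b, e a b.
Proof.
move=> m_gt0; apply: contrapT => no_edge.
have e0 a b : e a b = false by apply/negP => eab; case: no_edge; exists a, b.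
have L0 : laplacian_mx R e = 0.
  apply/matrixP => a b; rewrite !mxE e0 subr0.
  by rewrite eq_card0 ?mulr0 // => c; apply: e0.
pose l := Ordinal m_gt0.
(* Undoing the diagonalisation, this entry is also [lam 0 l], which is nonzero. *)
have : (M^t* *m laplacian_mx R e *m M) (w l) (w l) = 0.
  by rewrite L0 mulmx0 mul0mx mxE.
rewrite laplacianE !mulmxA mulmx_tC_unitary mul1mx -mulmxA mulmx_tC_unitary.
rewrite mulmx1 !mxE eqxx mulr1n (valK l : insub (w l : nat) = Some l) /=.
apply/eqP; exact: lam_neq0.
Qed.

(** The second factor is an entry of [M^* (e_a - e_b)]; the first cancels the weight in
    [LG_frame_inner]. *)
Definition edge_vector (a b : 'I_n) : 'cV[R[i]]_m :=
  \col_j (((D 0 j)^*%R)^-1 * ((M a (w j))^*%R - (M b (w j))^*%R)).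

(* The terms of the full sum [M M^* (e_a - e_b)] indexed by [c >= m] vanish,
   because those columns of [M] lie in the kernel of the Laplacian and hence
   take the same value at the two endpoints of an edge. *)
Lemma LG_frame_edge_vector (a b i : 'I_n) : symmetric e -> e a b ->
  inner (edge_vector a b) (frame_mx le_mn M lam *m delta_mx i 0) =
  (i == a)%:R - (i == b)%:R.
Proof.
move=> sym_e eab; rewrite LG_frame_inner.
pose F (c : 'I_n) := M i c * ((M a c)^*%R - (M b c)^*%R).
transitivity (\sum_(j < m) F (w j)).
  apply: eq_bigr => j _.
  have nzD : (D 0 j)^*%R != 0 by rewrite conjC_eq0 mxE sqrtC_eq0.
  by rewrite [edge_vector a b j 0]mxE /F; field.
rewrite -(big_ord_narrow (F := F) le_mn) /= big_mkcond.
transitivity (\sum_c F c).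
  apply: eq_bigr => c _; case: ltnP => // le_mc; rewrite /F.
  have := laplacian_ker_edge _ _ _ sym_e _ _ _ (laplacian_ker_col c le_mc) eab.
  by rewrite !mxE => ->; rewrite subrr mulr0.
have MM x : \sum_c M i c * (M x c)^*%R = (i == x)%:R.
  have /unitarymxP/matrixP/(_ i x) := unitM; rewrite !mxE => <-.
  by apply: eq_bigr => c _; rewrite !mxE.
by rewrite -!MM -sumrB; apply: eq_bigr => c _; rewrite /F mulrBr.
Qed.

End GraphFrames.

Theorem theorem4p3 (R : realType) (n k : nat) (e : rel 'I_n)
    (Phi : 'I_n -> 'cV[R[i]]_(n - k)) :
  (2 < n)%N -> (k < n)%N ->
  simple_graph e -> n_comp e predT = k ->
  LG_frame e Phi ->
  max_error_radius Phi (canonical_dual Phi) 2 = 1.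
Proof.
move=> _ lt_kn [sym_e irr_e] _ [le_mn [M [lam [unitM nz_lam laplE PhiE]]]].
have [||a [b eab]] := laplacian_has_edge _ _ _ e le_mn M lam _ nz_lam laplE => //.
  by rewrite subn_gt0.
have ne_ab : a != b by apply: contraTneq eab => ->; rewrite irr_e.
pose f := edge_vector R n _ le_mn M lam a b.
have fE i : inner f (Phi i) = (i == a)%:R - (i == b)%:R.
  by rewrite PhiE; apply: LG_frame_edge_vector laplE _ _ _ sym_e eab.
(* The extremal erasure set consists of the two endpoints of an edge. *)
apply: (@max_error_radius_canonical_dual _ _ _ _ _ _ [set a; b] f).
- by move=> g g0; apply: LG_frame_spanning unitM nz_lam _ _ => i; rewrite -PhiE.
- by rewrite cards2 ne_ab.
(* [f] is nonzero because its coefficient at [a] is 1. *)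
- apply: contra_eq_neq (fE a) => ->.
  by rewrite inner0l eqxx (negPf ne_ab) subr0 eq_sym oner_eq0.
by move=> i; rewrite !inE negb_or fE => /andP[/negPf-> /negPf->]; rewrite subrr.
Qed.
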